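(* Let $G=\langle a,b,r\mid aba^{-1}b^{-1}=r^2=(ra)^2=(rb)^2=1\rangle$ be the wallpaper group ''$p2$'', $\mathbb{C}G$ its group $*$-algebra and $\varepsilon\colon\mathbb{C}G\to\mathbb{C}$ the linear extension of the trivial representation. Then there are no non-zero Gaussian cocycles on $(\mathbb{C}G,\varepsilon)$. Therefore $(\mathbb{C}G,\varepsilon)$ has the properties (GC) and (LK).
   Context: The group $*$-algebra has involution $g^*=g^{-1}$, and $\varepsilon(g)=1$ for all group elements $g$. Put $A=\mathbb{C}G$. A pre-Hilbert space is a complex vector space $D$ with a positive definite inner product, linear in the second argument; $L(D)$ is the $*$-algebra of adjointable linear operators $D\to D$. A Gaussian cocycle on $(A,\varepsilon)$ is a linear map $\eta\colon A\to D$ into a pre-Hilbert space with $\eta(ab)=\varepsilon(a)\eta(b)+\eta(a)\varepsilon(b)$ for all $a,b\in A$. A generating functional on $(A,\varepsilon)$ is a linear $\psi\colon A\to\mathbb{C}$ with $\psi(1)=0$, $\psi(a^* )=\overline{\psi(a)}$ for all $a\in A$, and $\psi(a^*a)\ge0$ for all $a\in\ker\varepsilon$. A Schürmann triple $(\pi,\eta,\psi)$ over $D$ consists of a unital $*$-representation $\pi\colon A\to L(D)$, a $\pi$-$\varepsilon$-cocycle $\eta\colon A\to D$ (linear, $\eta(ab)=\pi(a)\eta(b)+\eta(a)\varepsilon(b)$), and a hermitian linear functional $\psi$ with $\varepsilon(a)\psi(b)-\psi(ab)+\psi(a)\varepsilon(b)=-\langle\eta(a^* ),\eta(b)\rangle$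 for all $a,b\in A$. Every generating functional $\psi$ is part of a Schürmann triple with $\eta$ surjective (GNS-type construction). Given such a triple with $\eta$ surjective, let $H$ be the completion of $D$, $H_R=\overline{\operatorname{span}}\{(\pi(a)-\varepsilon(a))v: a\in A, v\in D\}$, $H_G=H_R^\perp$, $P_G,P_R$ the orthogonal projections onto $H_G,H_R$, $D_G=P_GD$, $D_R=P_RD$, $\eta_G=P_G\circ\eta$, $\eta_R=P_R\circ\eta$. These are cocycles for the representations $\pi_G$ on $D_G$ and $\pi_R$ on $D_R$ given by $\pi_G(a)P_G\eta(b)=\varepsilon(a)P_G\eta(b)$ and $\pi_R(a)P_R\eta(b)=(\pi(a)-\varepsilon(a))\eta(b)+\varepsilon(a)P_R\eta(b)$. $\psi$ admits a Lévy-Khinchin decomposition if there are generating functionals $\psi_G,\psi_R$ with $\psi=\psi_G+\psi_R$ such that $(\pi_G,\eta_G,\psi_G)$ and $(\pi_R,\eta_R,\psi_R)$ are Schürmann triples. (GC): every Gaussian cocycle $\eta\colon A\to D$ (any pre-Hilbert space $D$) can be completed to a Schürmann triple $(\varepsilon\operatorname{id}_D,\eta,\psi)$. (LK): every generating functional on $(A,\varepsilon)$ admits a Lévy-Khinchin decomposition. *)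

(* Defs.v *)
From HB Require Import structures.
From mathcomp Require Import all_boot all_order all_algebra.
From mathcomp Require Import finmap.
From mathcomp Require Import boolp.
From mathcomp.multinomials Require Import monalg.

Set Implicit Arguments.
Unset Strict Implicit.
Unset Printing Implicit Defensive.

Import Order.TTheory GRing.Theory Num.Theory.

Local Open Scope ring_scope.

Section Presentation.
Variables (X : choiceType).

(* (x, true) stands for the generator x and (x, false) for its inverse. *)
Definition word := seq (X * bool).
Definition inv_word (w : word) : word := rev [seq (l.1, ~~ l.2) | l <- w].

Variable rels : seq word.

Inductive word_eqv : word -> word -> Prop :=
| weqv_refl u : word_eqv u u
| weqv_sym u v : word_eqv u v -> word_eqv v u
| weqv_trans u v w : word_eqv u v -> word_eqv v w -> word_eqv u w
| weqv_cancel u v x e : word_eqv (u ++ [:: (x, e); (x, ~~ e)] ++ v) (u ++ v)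
| weqv_rel u v w : w \in rels -> word_eqv (u ++ w ++ v) (u ++ v).

Definition word_eqb (u v : word) : bool := `[< word_eqv u v >].

Lemma word_eqb_refl : reflexive word_eqb.
Proof. by move=> u; apply/asboolP; apply: weqv_refl. Qed.
Lemma word_eqb_sym : symmetric word_eqb.
Proof. by move=> u v; apply/idP/idP => /asboolP h; apply/asboolP/weqv_sym. Qed.
Lemma word_eqb_trans : transitive word_eqb.
Proof.
by move=> v u w /asboolP h1 /asboolP h2; apply/asboolP/(weqv_trans h1).
Qed.

Canonical word_equiv := EquivRel word_eqb word_eqb_refl word_eqb_sym word_eqb_trans.

Definition presented_group := {eq_quot word_equiv}%qT.
HB.instance Definition _ := Choice.on presented_group.

Definition word_class (w : word) : presented_group := (\pi_presented_group w)%qT.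
Definition pg_one := word_class [::].
Definition pg_mul (g h : presented_group) := word_class (repr g ++ repr h).
Definition pg_inv (g : presented_group) := word_class (inv_word (repr g)).

Lemma word_classP u v : word_class u = word_class v <-> word_eqv u v.
Proof.
split=> [/eqP|h]; last by apply/eqP; rewrite eqmodE; apply/asboolP.
by rewrite eqmodE => /asboolP.
Qed.

Lemma word_eqv_cat u u' v v' :
  word_eqv u u' -> word_eqv v v' -> word_eqv (u ++ v) (u' ++ v').
Proof.
move=> hu hv; apply: (@weqv_trans _ (u' ++ v)).
  elim: hu => {u u'} [u|u u' _|u1 u2 u3 _ h1 _|u w x e|u w r hr].
  - exact: weqv_refl.
  - exact: weqv_sym.
  - exact: weqv_trans.
  - by rewrite -!catA; apply: (weqv_cancel u (w ++ v)).
  - by rewrite -!catA; apply: weqv_rel.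
elim: hv => {v v'} [v|v v' _|v1 v2 v3 _ h1 _|v w x e|v w r hr].
- exact: weqv_refl.
- exact: weqv_sym.
- exact: weqv_trans.
- by rewrite !(catA u'); apply: weqv_cancel.
- by rewrite !(catA u'); apply: weqv_rel.
Qed.

Lemma word_eqv_repr w : word_eqv (repr (word_class w)) w.
Proof. by apply/word_classP; rewrite /word_class reprK. Qed.

Lemma pg_mulE u v : pg_mul (word_class u) (word_class v) = word_class (u ++ v).
Proof. by apply/word_classP; apply: word_eqv_cat; apply: word_eqv_repr. Qed.

Lemma word_classK g : word_class (repr g) = g.
Proof. exact: reprK. Qed.

Lemma inv_wordK : involutive inv_word.
Proof.
move=> w; rewrite /inv_word map_rev revK -map_comp -[RHS]map_id.
by apply: eq_map => -[x e] /=; rewrite negbK.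
Qed.

Lemma weqv_inv_r w : word_eqv (w ++ inv_word w) [::].
Proof.
elim: w => [|[x e] w IH]; first exact: weqv_refl.
rewrite /inv_word /= rev_cons -cats1 -/(inv_word w).
apply: weqv_trans (weqv_cancel [::] [::] x e).
rewrite -cat1s -[X in word_eqv _ X]/([:: (x, e)] ++ [:: (x, ~~ e)]).
apply: word_eqv_cat; first exact: weqv_refl.
by rewrite catA; apply: (word_eqv_cat IH); apply: weqv_refl.
Qed.

Lemma pg_mulA : associative pg_mul.
Proof.
move=> g h k; rewrite -[g]word_classK -[h]word_classK -[k]word_classK.
by rewrite !pg_mulE catA.
Qed.
Lemma pg_mul1 : left_id pg_one pg_mul.
Proof. by move=> g; rewrite -[g]word_classK pg_mulE. Qed.
Lemma pg_mulr1 : right_id pg_one pg_mul.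
Proof. by move=> g; rewrite -[g]word_classK pg_mulE cats0. Qed.
Lemma pg_mulrV : right_inverse pg_one pg_inv pg_mul.
Proof.
move=> g; rewrite -{1}[g]word_classK /pg_inv pg_mulE.
by apply/word_classP/weqv_inv_r.
Qed.
Lemma pg_mulV : left_inverse pg_one pg_inv pg_mul.
Proof.
move=> g; rewrite -{2}[g]word_classK /pg_inv pg_mulE.
by apply/word_classP; rewrite -{2}[repr g]inv_wordK; apply: weqv_inv_r.
Qed.

HB.instance Definition _ := isGroup.Build presented_group
  pg_mulA pg_mul1 pg_mulr1 pg_mulV pg_mulrV.

End Presentation.

(* The generators a, b, r are 0, 1, 2 : 'I_3. *)
Definition p2_relators : seq (word 'I_3) :=
  let a := (inord 0 : 'I_3, true) in let a' := (inord 0 : 'I_3, false) in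
  let b := (inord 1 : 'I_3, true) in let b' := (inord 1 : 'I_3, false) in
  let r := (inord 2 : 'I_3, true) in
  [:: [:: a; b; a'; b']; [:: r; r]; [:: r; a; r; a]; [:: r; b; r; b]].

Definition p2 : groupType := presented_group p2_relators.

Section GroupAlgebra.
Variables (C : numClosedFieldType) (G : groupType).

(* [{malg C[G]}] has a product in the library only for monoids without
   non-trivial units, hence the alias and the convolution below. *)
Definition group_algebra := {malg C[G]}.
HB.instance Definition _ := GRing.Lmodule.on group_algebra.

Implicit Types (f : group_algebra) (g h : G).

Definition ga_one : group_algebra := << 1%g >>.
Definition ga_mul f1 f2 : group_algebra :=
  \sum_(g <- msupp f1) \sum_(h <- msupp f2) << f1@_g * f2@_h *g (g * h)%g >>.
Definition ga_star f : group_algebra :=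
  \sum_(g <- msupp f) << (f@_g)^* *g g^-1%g >>.
Definition ga_eps f : C := \sum_(g <- msupp f) f@_g.

Lemma ga_mulw (d1 d2 : {fset G}) f1 f2 :
  (msupp f1 `<=` d1)%fset -> (msupp f2 `<=` d2)%fset ->
  ga_mul f1 f2 =
  \sum_(g <- d1) \sum_(h <- d2) << f1@_g * f2@_h *g (g * h)%g >>.
Proof.
move=> le1 le2; rewrite /ga_mul (big_fset_incl _ le1) /=.
  apply: eq_bigr => g _; apply: big_fset_incl => // h _ /mcoeff_outdom ->.
  by rewrite mulr0 monalgU0.
move=> g _ /mcoeff_outdom f1g.
by rewrite big1 // => h _; rewrite f1g mul0r monalgU0.
Qed.

Lemma ga_mulDl : left_distributive ga_mul +%R.
Proof.
move=> f1 f2 f; set d := (msupp f1 `|` msupp f2)%fset.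
have [l1 l2] : (msupp f1 `<=` d)%fset /\ (msupp f2 `<=` d)%fset.
  by rewrite fsubsetUl fsubsetUr.
rewrite (ga_mulw l1 (fsubset_refl _)) (ga_mulw l2 (fsubset_refl _)).
rewrite (ga_mulw (msuppD_le _ _) (fsubset_refl _)) -big_split /=.
apply: eq_bigr => g _; rewrite -big_split /=; apply: eq_bigr => h _.
by rewrite mcoeffD mulrDl monalgUD.
Qed.

Lemma ga_mulDr : right_distributive ga_mul +%R.
Proof.
move=> f f1 f2; set d := (msupp f1 `|` msupp f2)%fset.
have [l1 l2] : (msupp f1 `<=` d)%fset /\ (msupp f2 `<=` d)%fset.
  by rewrite fsubsetUl fsubsetUr.
rewrite (ga_mulw (fsubset_refl _) l1) (ga_mulw (fsubset_refl _) l2).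
rewrite (ga_mulw (fsubset_refl _) (msuppD_le _ _)) -big_split /=.
apply: eq_bigr => g _; rewrite -big_split /=; apply: eq_bigr => h _.
by rewrite mcoeffD mulrDr monalgUD.
Qed.

Lemma ga_mul0 : left_zero 0 ga_mul.
Proof. by move=> f; rewrite /ga_mul msupp0 big_seq_fset0. Qed.

Lemma ga_mulr0 : right_zero 0 ga_mul.
Proof. by move=> f; rewrite /ga_mul big1 // => g _; rewrite msupp0 big_seq_fset0. Qed.

Lemma ga_ind (P : group_algebra -> Prop) :
  P 0 -> (forall f1 f2, P f1 -> P f2 -> P (f1 + f2)) ->
  (forall c g, P << c *g g >>) -> forall f, P f.
Proof. by move=> P0 PD PU f; rewrite [f]monalgE; apply: big_ind. Qed.

Lemma ga_mulUU (c d : C) g h :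
  ga_mul << c *g g >> << d *g h >> = << c * d *g (g * h)%g >>.
Proof. by rewrite (ga_mulw msuppU_le msuppU_le) !big_seq_fset1 !mcoeffUU. Qed.

Lemma ga_scaleU (c d : C) g : c *: (<< d *g g >> : group_algebra) = << c * d *g g >>.
Proof. by apply/malgP => h; rewrite mcoeffZ !mcoeffU mulrnAr. Qed.

Lemma ga_mul1 : left_id ga_one ga_mul.
Proof.
move=> f; elim/ga_ind: f => [|f1 f2 IH1 IH2|c g]; first exact: ga_mulr0.
  by rewrite ga_mulDr IH1 IH2.
by rewrite ga_mulUU mul1r mul1g.
Qed.

Lemma ga_mulr1 : right_id ga_one ga_mul.
Proof.
move=> f; elim/ga_ind: f => [|f1 f2 IH1 IH2|c g]; first exact: ga_mul0.
  by rewrite ga_mulDl IH1 IH2.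
by rewrite ga_mulUU mulr1 mulg1.
Qed.

Lemma ga_mulA : associative ga_mul.
Proof.
move=> f1 f2 f3.
elim/ga_ind: f1 => [|f f' IH IH'|c g]; first by rewrite !ga_mul0.
  by rewrite !ga_mulDl IH IH'.
elim/ga_ind: f2 => [|f f' IH IH'|d h]; first by rewrite ga_mulr0 !ga_mul0 ga_mulr0.
  by rewrite ga_mulDr !ga_mulDl ga_mulDr IH IH'.
elim/ga_ind: f3 => [|f f' IH IH'|e k]; first by rewrite !ga_mulr0.
  by rewrite !ga_mulDr IH IH'.
by rewrite !ga_mulUU mulrA mulgA.
Qed.

Lemma ga_one_neq0 : ga_one != 0.
Proof.
by apply/eqP => /malgP /(_ 1%g) /eqP; rewrite mcoeffUU mcoeff0 oner_eq0.
Qed.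

HB.instance Definition _ := GRing.Zmodule_isNzRing.Build group_algebra
  ga_mulA ga_mul1 ga_mulr1 ga_mulDl ga_mulDr ga_one_neq0.

Lemma ga_mulrUU (c d : C) g h :
  (<< c *g g >> : group_algebra) * << d *g h >> = << c * d *g (g * h)%g >>.
Proof. exact: ga_mulUU. Qed.

Lemma ga_scaleAl (c : C) f1 f2 : c *: (f1 * f2) = (c *: f1) * f2.
Proof.
elim/ga_ind: f1 => [|f f' IH IH'|d g]; first by rewrite !(scaler0, mul0r).
  by rewrite mulrDl !scalerDr IH IH' mulrDl.
elim/ga_ind: f2 => [|f f' IH IH'|e h]; first by rewrite !(scaler0, mulr0).
  by rewrite mulrDr !scalerDr IH IH' mulrDr.
by rewrite ga_scaleU !ga_mulrUU ga_scaleU mulrA.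
Qed.

HB.instance Definition _ :=
  GRing.Lmodule_isLalgebra.Build C group_algebra ga_scaleAl.

Lemma ga_scaleAr (c : C) f1 f2 : c *: (f1 * f2) = f1 * (c *: f2).
Proof.
elim/ga_ind: f1 => [|f f' IH IH'|d g]; first by rewrite !(scaler0, mul0r).
  by rewrite mulrDl !scalerDr IH IH' mulrDl.
elim/ga_ind: f2 => [|f f' IH IH'|e h]; first by rewrite !(scaler0, mulr0).
  by rewrite mulrDr !scalerDr IH IH' mulrDr.
by rewrite ga_scaleU !ga_mulrUU ga_scaleU mulrCA.
Qed.

HB.instance Definition _ :=
  GRing.Lalgebra_isAlgebra.Build C group_algebra ga_scaleAr.

Lemma ga_starw (d : {fset G}) f : (msupp f `<=` d)%fset ->
  ga_star f = \sum_(g <- d) << (f@_g)^* *g g^-1%g >>.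
Proof.
move=> le_d; apply: big_fset_incl => // g _ /mcoeff_outdom ->.
by rewrite conjC0 monalgU0.
Qed.

Lemma ga_epsw (d : {fset G}) f : (msupp f `<=` d)%fset ->
  ga_eps f = \sum_(g <- d) f@_g.
Proof. by move=> le_d; apply: big_fset_incl => // g _ /mcoeff_outdom ->. Qed.

Lemma ga_star_linear c f1 f2 :
  ga_star (c *: f1 + f2) = c^* *: ga_star f1 + ga_star f2.
Proof.
have l : (msupp (c *: f1 + f2) `<=` msupp f1 `|` msupp f2)%fset.
  exact: fsubset_trans (msuppD_le _ _) (fsetSU _ (msuppZ_le _ _)).
rewrite (ga_starw l) (ga_starw (fsubsetUl _ (msupp f2))).
rewrite (ga_starw (fsubsetUr (msupp f1) _)) scaler_sumr -big_split /=.
apply: eq_bigr => g _.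
by rewrite ga_scaleU mcoeffD mcoeffZ rmorphD rmorphM monalgUD.
Qed.

Lemma ga_eps_linear : scalar ga_eps.
Proof.
move=> c f1 f2.
have l : (msupp (c *: f1 + f2) `<=` msupp f1 `|` msupp f2)%fset.
  exact: fsubset_trans (msuppD_le _ _) (fsetSU _ (msuppZ_le _ _)).
rewrite (ga_epsw l) (ga_epsw (fsubsetUl _ (msupp f2))).
rewrite (ga_epsw (fsubsetUr (msupp f1) _)) mulr_sumr -big_split /=.
by apply: eq_bigr => g _; rewrite mcoeffD mcoeffZ.
Qed.

Lemma ga_starU c g : ga_star << c *g g >> = << c^* *g g^-1%g >>.
Proof. by rewrite (ga_starw msuppU_le) big_seq_fset1 mcoeffUU. Qed.

Lemma ga_epsU c g : ga_eps << c *g g >> = c.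
Proof. by rewrite (ga_epsw msuppU_le) big_seq_fset1 mcoeffUU. Qed.

Lemma ga_starD f1 f2 : ga_star (f1 + f2) = ga_star f1 + ga_star f2.
Proof. by rewrite -[f1]scale1r ga_star_linear conjC1 !scale1r. Qed.

Lemma ga_star0 : ga_star 0 = 0.
Proof. by rewrite /ga_star msupp0 big_seq_fset0. Qed.

Lemma ga_epsD f1 f2 : ga_eps (f1 + f2) = ga_eps f1 + ga_eps f2.
Proof. by rewrite -[f1]scale1r ga_eps_linear mul1r scale1r. Qed.

Lemma ga_eps0 : ga_eps 0 = 0.
Proof. by rewrite /ga_eps msupp0 big_seq_fset0. Qed.

Lemma ga_starM f1 f2 : ga_star (f1 * f2) = ga_star f2 * ga_star f1.
Proof.
elim/ga_ind: f1 => [|f f' IH IH'|c g].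
- by rewrite mul0r !ga_star0 mulr0.
- by rewrite mulrDl !ga_starD IH IH' mulrDr.
elim/ga_ind: f2 => [|f f' IH IH'|d h].
- by rewrite mulr0 !ga_star0 mul0r.
- by rewrite mulrDr !ga_starD IH IH' mulrDl.
by rewrite ga_mulrUU !ga_starU ga_mulrUU rmorphM mulrC invgM.
Qed.

Lemma ga_starK : involutive ga_star.
Proof.
move=> f; elim/ga_ind: f => [|f1 f2 IH1 IH2|c g]; first by rewrite !ga_star0.
  by rewrite !ga_starD IH1 IH2.
by rewrite !ga_starU conjCK invgK.
Qed.

Lemma ga_eps1 : ga_eps 1 = 1.
Proof. exact: ga_epsU. Qed.

Lemma ga_epsM f1 f2 : ga_eps (f1 * f2) = ga_eps f1 * ga_eps f2.
Proof.
elim/ga_ind: f1 => [|f f' IH IH'|c g].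
- by rewrite mul0r !ga_eps0 mul0r.
- by rewrite mulrDl !ga_epsD IH IH' mulrDl.
elim/ga_ind: f2 => [|f f' IH IH'|d h].
- by rewrite mulr0 !ga_eps0 mulr0.
- by rewrite mulrDr !ga_epsD IH IH' mulrDr.
by rewrite ga_mulrUU !ga_epsU.
Qed.

Lemma ga_eps_star f : ga_eps (ga_star f) = (ga_eps f)^*.
Proof.
elim/ga_ind: f => [|f1 f2 IH1 IH2|c g]; first by rewrite ga_star0 !ga_eps0 conjC0.
  by rewrite ga_starD !ga_epsD IH1 IH2 rmorphD.
by rewrite ga_starU !ga_epsU.
Qed.

End GroupAlgebra.

Record augmented_star_algebra (C : numClosedFieldType) := AugmentedStarAlgebra {
  asa_sort :> algType C;
  star : asa_sort -> asa_sort;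
  eps : asa_sort -> C;
  star_linear : forall c x y, star (c *: x + y) = c^* *: star x + star y;
  starM : forall x y, star (x * y) = star y * star x;
  starK : involutive star;
  eps_linear : scalar eps;
  eps1 : eps 1 = 1;
  epsM : forall x y, eps (x * y) = eps x * eps y;
  eps_star : forall x, eps (star x) = (eps x)^*
}.

Definition group_star_algebra (C : numClosedFieldType) (G : groupType) :
    augmented_star_algebra C :=
  @AugmentedStarAlgebra C (group_algebra C G) (@ga_star C G) (@ga_eps C G)
    (@ga_star_linear C G) (@ga_starM C G) (@ga_starK C G) (@ga_eps_linear C G)
    (@ga_eps1 C G) (@ga_epsM C G) (@ga_eps_star C G).

Record preHilbert (C : numClosedFieldType) := PreHilbert {
  ph_sort :> lmodType C;
  ph_dot : {dot ph_sort for Num.conj}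
}.

(* [{dot _ for _}] is linear in its first argument. *)
Definition inner (C : numClosedFieldType) (V : preHilbert C) (x y : V) : C :=
  ph_dot V y x.

Definition hnorm (C : numClosedFieldType) (V : preHilbert C) (x : V) : C :=
  sqrtC (inner x x).

Section Image.
Variables (C : numClosedFieldType) (D : lmodType C) (H : preHilbert C).
Variable f : {linear D -> H}.

Definition in_image : {pred H} := fun x => `[< exists v, f v = x >].

Lemma in_image_submod : submod_closed in_image.
Proof.
split; first by apply/asboolP; exists 0; rewrite linear0.
move=> c x y /asboolP[v <-] /asboolP[w <-]; apply/asboolP.
by exists (c *: v + w); rewrite linearP.
Qed.

HB.instance Definition _ := GRing.isSubmodClosed.Build C H in_image in_image_submod.

Record image := Image { image_val :> H; _ : image_val \in in_image }.
HB.instance Definition _ := [isSub for image_val].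
HB.instance Definition _ := [Choice of image by <:].
HB.instance Definition _ := [SubChoice_isSubLmodule of image by <:].

Definition image_dot (x y : image) : C := ph_dot H (val x) (val y).

Lemma image_dot_bilinear : bilinear_for *%R (Num.conj \; *%R) image_dot.
Proof.
split=> [y|x] c u v; rewrite /image_dot [val (c *: u + v)]linearP.
  exact: linearPl.
exact: linearPr.
Qed.

Lemma image_dot_hermitian x y :
  image_dot x y = (-1) ^+ false * (image_dot y x)^*.
Proof. exact: hermitian_subproof. Qed.

Lemma image_dot_pos x : x != 0 -> 0 < image_dot x x.
Proof.
move=> x0; apply: neq0_dnorm_gt0; apply: contra x0 => /eqP x0.
by apply/eqP/val_inj; rewrite x0 linear0.
Qed.

HB.instance Definition _ := bilinear_isBilinear.Build C image image C
  *%R (Num.conj \; *%R) image_dot image_dot_bilinear.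
HB.instance Definition _ :=
  isHermitianSesquilinear.Build C image false Num.conj image_dot image_dot_hermitian.
HB.instance Definition _ := isDotProduct.Build C image image_dot image_dot_pos.

Definition image_space : preHilbert C :=
  @PreHilbert C image (image_dot : {dot image for Num.conj}).

Fact in_image_app v : f v \in in_image.
Proof. by apply/asboolP; exists v. Qed.

Definition to_image (v : D) : image_space := Image (in_image_app v).

Lemma to_image_linear : linear to_image.
Proof. by move=> c u v; apply: val_inj; rewrite [RHS]linearP; apply: linearP. Qed.

HB.instance Definition _ :=
  GRing.isLinear.Build C D image_space *:%R to_image to_image_linear.

End Image.

Section Hilbert.
Variables (C : numClosedFieldType).

(* Over [C := R[i]], [0 < e] says that [e] is a positive real number. *)
Definition complete_space (H : preHilbert C) : Prop :=
  forall u : nat -> H,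
    (forall e : C, 0 < e -> exists N, forall m n, (N <= m)%N -> (N <= n)%N ->
       hnorm (u m - u n) < e) ->
    exists l : H, forall e : C, 0 < e -> exists N, forall n, (N <= n)%N ->
      hnorm (u n - l) < e.

Definition is_completion (D H : preHilbert C) (J : {linear D -> H}) : Prop :=
  [/\ complete_space H,
      forall v w : D, inner (J v) (J w) = inner v w &
      forall (x : H) (e : C), 0 < e -> exists v : D, hnorm (x - J v) < e].

Definition span (H : preHilbert C) (S : H -> Prop) : H -> Prop := fun x =>
  exists (n : nat) (c : 'I_n -> C) (y : 'I_n -> H),
    (forall i, S (y i)) /\ x = \sum_(i < n) c i *: y i.

Definition norm_closure (H : preHilbert C) (S : H -> Prop) : H -> Prop := fun x =>
  forall e : C, 0 < e -> exists2 y, S y & hnorm (x - y) < e.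

Definition orthogonal_compl (H : preHilbert C) (S : H -> Prop) : H -> Prop :=
  fun x => forall y, S y -> inner y x = 0.

Definition is_orth_proj (H : preHilbert C) (P : H -> H) (S : H -> Prop) : Prop :=
  forall x, S (P x) /\ orthogonal_compl S (x - P x).

End Hilbert.

Section Schurmann.
Variables (C : numClosedFieldType) (A : augmented_star_algebra C).

Definition hermitian_functional (psi : A -> C) : Prop :=
  forall a, psi (star a) = (psi a)^*.

Definition generating_functional (psi : {scalar A}) : Prop :=
  [/\ psi 1 = 0, hermitian_functional psi &
      forall a, eps a = 0 -> 0 <= psi (star a * a)].

(* [pi : A -> D -> D] encodes a unital *-homomorphism from [A] to the adjointable
   operators on [D]; [pi (star a)] is the adjoint of [pi a]. *)
Definition star_representation (D : preHilbert C) (pi : A -> D -> D) : Prop :=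
  [/\ forall a, linear (pi a),
      forall v, linear (pi ^~ v),
      forall v, pi 1 v = v,
      forall a b v, pi (a * b) v = pi a (pi b v) &
      forall a v w, inner (pi (star a) v) w = inner v (pi a w)].

Definition cocycle (D : preHilbert C) (pi : A -> D -> D)
    (eta : {linear A -> D}) : Prop :=
  forall a b, eta (a * b) = pi a (eta b) + eps b *: eta a.

Definition eps_id (D : preHilbert C) (a : A) (v : D) : D := eps a *: v.

Definition gaussian_cocycle (D : preHilbert C) (eta : {linear A -> D}) : Prop :=
  forall a b, eta (a * b) = eps a *: eta b + eps b *: eta a.

Definition schurmann_triple (D : preHilbert C) (pi : A -> D -> D)
    (eta : {linear A -> D}) (psi : {scalar A}) : Prop :=
  [/\ star_representation pi, cocycle pi eta, hermitian_functional psi &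
      forall a b, eps a * psi b - psi (a * b) + psi a * eps b
        = - inner (eta (star a)) (eta b)].

Definition GC : Prop :=
  forall (D : preHilbert C) (eta : {linear A -> D}), gaussian_cocycle eta ->
    exists psi : {scalar A}, schurmann_triple (@eps_id D) eta psi.

Section LevyKhinchin.
Variables (D H : preHilbert C) (J : {linear D -> H}).
Variables (pi : A -> D -> D) (eta : {linear A -> D}).

Definition remainder_space : H -> Prop :=
  norm_closure (span (fun x => exists a v, x = J (pi a v - eps a *: v))).

Definition gaussian_space : H -> Prop := orthogonal_compl remainder_space.

Definition LK_decomposition (PG PR : {linear H -> H})
    (psi psiG psiR : {scalar A}) : Prop :=
  let etaG := (to_image (PG \o J) \o eta : {linear A -> _}) in
  let etaR := (to_image (PR \o J) \o eta : {linear A -> _}) in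
  [/\ generating_functional psiG, generating_functional psiR,
      forall a, psi a = psiG a + psiR a,
      exists2 piG : A -> image_space (PG \o J) -> image_space (PG \o J),
        forall a b, piG a (etaG b) = eps a *: etaG b
        & schurmann_triple piG etaG psiG &
      exists2 piR : A -> image_space (PR \o J) -> image_space (PR \o J),
        forall a b, image_val (piR a (etaR b))
          = J (pi a (eta b) - eps a *: eta b) + eps a *: PR (J (eta b))
        & schurmann_triple piR etaR psiR].

End LevyKhinchin.

(* The Schurmann triple of [psi] with surjective cocycle and the completion of its
   space are unique up to unitary equivalence, and exist when [psi] is
   generating. *)
Definition admits_LK (psi : {scalar A}) : Prop :=
  exists (D : preHilbert C) (pi : A -> D -> D) (eta : {linear A -> D})
         (H : preHilbert C) (J : {linear D -> H}) (PG PR : {linear H -> H})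
         (psiG psiR : {scalar A}),
    [/\ schurmann_triple pi eta psi /\ (forall v, exists a, eta a = v),
        is_completion J,
        is_orth_proj PG (gaussian_space J pi),
        is_orth_proj PR (remainder_space J pi) &
        LK_decomposition J pi eta PG PR psi psiG psiR].

Definition LK : Prop :=
  forall psi : {scalar A}, generating_functional psi -> admits_LK psi.

End Schurmann.

(* Main.v *)
Require Import Defs.
From HB Require Import structures.
From mathcomp Require Import all_boot all_order all_algebra.
From mathcomp Require Import boolp classical_sets functions reals.
From mathcomp Require Import topology normedtype ring.
From mathcomp.real_closed Require Import complex.
From mathcomp.multinomials Require monalg.

(** Everything follows from the fact that the group p2 is generated by the three
    involutions r, ra and rb.

    Let eta be a pi-eps-cocycle on the group algebra of G.  Then
      eta (gh) = (pi g - 1) (eta h) + eta g + eta h,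
    so modulo the span S of the increments (pi a - eps a) v the map eta is
    additive on G.  If g is an involution, 2 eta g is congruent to eta 1 = 0, so
    eta g lies in S; when involutions generate G, eta takes all its values in S
    ([cocycle_increments]).

    For a Gaussian cocycle all increments vanish, so S = 0 and eta = 0.  Then the
    zero functional completes eta to a Schurmann triple, which is (GC).

    For (LK), let eta be the surjective cocycle of a generating functional psi.
    Then S is the whole space D, so H_R, the closure of S, is the whole completion
    H and H_G = 0.  The projections are therefore P_R = id and P_G = 0, and
    psi = 0 + psi is a Levy-Khinchin decomposition: the Gaussian part is the zero
    triple, and the remainder is the given triple moved along the isometry of D
    onto its image in H ([transport_triple]).

    What remains is to produce the triple and the completion.  Both are quotients
    of a vector space with a positive semidefinite form by its null vectors
    ([psd_separation]): the form psi ((a - eps a)^* (b - eps b)) on the algebra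
    gives D ([gns_construction]), and the limit of the inner products of the
    terms, on the space of Cauchy sequences of D, gives H
    ([completion_exists]). *)

Set Implicit Arguments.
Unset Strict Implicit.
Unset Printing Implicit Defensive.

Import Order.TTheory GRing.Theory Num.Theory.
Import numFieldNormedType.Exports.
Local Open Scope classical_set_scope.
Local Open Scope ring_scope.

(** * Positive semidefinite forms *)

Record psd_form (C : numClosedFieldType) (V : lmodType C) := PsdForm {
  psd_fun :> V -> V -> C;
  psd_linear : forall x, scalar (psd_fun x);
  psd_conj : forall x y, (psd_fun x y)^* = psd_fun y x;
  psd_ge0 : forall x, 0 <= psd_fun x x
}.

Section PsdTheory.
Variables (C : numClosedFieldType) (V : lmodType C) (K : psd_form V).
Implicit Types (x y z : V) (c : C).

Lemma psdDr x y z : K x (y + z) = K x y + K x z.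
Proof. by rewrite -[y]scale1r psd_linear mul1r scale1r. Qed.

Lemma psd0r x : K x 0 = 0.
Proof. by apply: (addIr (K x 0)); rewrite -psdDr !add0r. Qed.

Lemma psdZr c x y : K x (c *: y) = c * K x y.
Proof. by rewrite -[c *: y]addr0 psd_linear psd0r addr0. Qed.

Lemma psdBr x y z : K x (y - z) = K x y - K x z.
Proof. by rewrite -scaleN1r psdDr psdZr mulN1r. Qed.

Lemma psdDl x y z : K (x + y) z = K x z + K y z.
Proof. by rewrite -psd_conj psdDr rmorphD /= !psd_conj. Qed.

Lemma psdZl c x y : K (c *: x) y = c^* * K x y.
Proof. by rewrite -psd_conj psdZr rmorphM /= psd_conj. Qed.

Lemma psdBl x y z : K (x - y) z = K x z - K y z.
Proof. by rewrite -psd_conj psdBr rmorphB /= !psd_conj. Qed.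

Definition psd_norm x : C := sqrtC (K x x).

Lemma psd_norm_ge0 x : 0 <= psd_norm x.
Proof. by rewrite sqrtC_ge0 psd_ge0. Qed.

Lemma psd_normE x : psd_norm x ^+ 2 = K x x.
Proof. exact: sqrtCK. Qed.

(** The value of the form at [y - s (K x y) x]; the Cauchy-Schwarz inequality
    comes from a good choice of [s]. *)
Lemma psd_quadratic x y s : s \is Num.real ->
  0 <= K y y - `|K x y| ^+ 2 * (s *+ 2 - s ^+ 2 * K x x).
Proof.
move=> /CrealP sr; have := psd_ge0 K (y - (s * K x y) *: x).
rewrite !(psdBl, psdBr, psdZl, psdZr) rmorphM /= sr normCK -[K y x]psd_conj.
by congr (_ <= _); ring.
Qed.

Lemma psd_CauchySchwarz x y : `|K x y| <= psd_norm x * psd_norm y.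
Proof.
rewrite -ler_sqr ?nnegrE ?mulr_ge0 ?psd_norm_ge0 // exprMn !psd_normE.
have [a0|a0] := eqVneq (K x x) 0.
  have [->|b0] := eqVneq (K x y) 0; first by rewrite normr0 expr0n mulr_ge0 ?psd_ge0.
  have b2 : `|K x y| ^+ 2 != 0 by rewrite expf_neq0 // normr_eq0.
  (* When [K x x = 0], the form is affine in [s] with a negative slope; the [s]
     chosen here makes its value [- K y y - 2], which is negative. *)
  have := @psd_quadratic x y ((K y y + 1) / `|K x y| ^+ 2).
  have sr : (K y y + 1) / `|K x y| ^+ 2 \is Num.real.
    by rewrite realM ?realV ?realX ?realD ?real1 ?normr_real ?ger0_real ?psd_ge0.
  move=> /(_ sr).
  rewrite a0 mulr0 subr0 mulrnAr mulrCA divff // mulr1.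
  rewrite subr_ge0 lt_geF // mulr2n -addrA ltrDl.
  by rewrite ltr_wpDl ?ltr_wpDl ?addr_ge0 ?ltr01 ?psd_ge0.
have a_gt0 : 0 < K x x by rewrite lt_def a0 psd_ge0.
have := @psd_quadratic x y (K x x)^-1.
rewrite realV gtr0_real // => /(_ isT).
rewrite (expr2 (K x x)^-1) -[_ * K x x]mulrA mulVf // mulr1 mulr2n addrK subr_ge0.
by rewrite ler_pdivrMr // mulrC.
Qed.

Lemma psd_normD x y : psd_norm (x + y) <= psd_norm x + psd_norm y.
Proof.
have xy0 : 0 <= psd_norm x + psd_norm y by rewrite addr_ge0 ?psd_norm_ge0.
rewrite -ler_sqr ?nnegrE ?psd_norm_ge0 // psd_normE sqrrD !psd_normE.
rewrite psdDr !psdDl -[K y x]psd_conj.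
rewrite [leLHS](_ : _ = K x x + (K x y + (K x y)^*) + K y y); last by ring.
rewrite lerD2r lerD2l.
have -> : K x y + (K x y)^* = 'Re (K x y) *+ 2.
  by rewrite -mulr_natr ReE mulfVK // pnatr_eq0.
rewrite lerMn2r; apply: le_trans (psd_CauchySchwarz x y).
exact: le_trans (leif_Re_Creal _) _.
Qed.

Lemma psd_normZ c x : psd_norm (c *: x) = `|c| * psd_norm x.
Proof.
rewrite /psd_norm psdZr psdZl mulrA -normCK sqrtCM ?nnegrE ?psd_ge0 ?exprn_ge0 //.
by rewrite sqrCK.
Qed.

Lemma psd_normB x y : psd_norm (x - y) = psd_norm (y - x).
Proof. by rewrite -[x - y]opprB -[- (y - x)]scaleN1r psd_normZ normrN1 mul1r. Qed.

Lemma psd_dist_triangle y x z :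
  psd_norm (x - z) <= psd_norm (x - y) + psd_norm (y - z).
Proof. by rewrite -[x - z](subrKA y) psd_normD. Qed.

Lemma psd_norm0 : psd_norm 0 = 0.
Proof. by rewrite /psd_norm psd0r sqrtC0. Qed.

(** A vector of length zero is orthogonal to everything, so that the vectors of
    length zero form a subspace that can be divided out. *)
Lemma psd_null x y : K x x = 0 -> K y x = 0.
Proof.
move=> x0; apply/eqP; rewrite -normr_eq0 eq_le normr_ge0 andbT.
by rewrite -[0](mulr0 (psd_norm y)) -sqrtC0 -x0 psd_CauchySchwarz.
Qed.

End PsdTheory.

(** * The pre-Hilbert space of a positive semidefinite form *)

Section Separation.
Variables (C : numClosedFieldType) (V : lmodType C) (K : psd_form V).

(** The quotient of [V] by the null vectors of [K] is realized inside [V -> C],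
    the class of [x] being the functional [K ^~ x]: two vectors have the same
    functional exactly when they differ by a null vector. *)
Definition separated : {pred V -> C} := fun f => `[< exists x, (K ^~ x) = f >].

Lemma separated_submod : submod_closed separated.
Proof.
split; first by apply/asboolP; exists 0; apply/funext => y; rewrite psd0r.
move=> c f g /asboolP[x <-] /asboolP[y <-]; apply/asboolP.
by exists (c *: x + y); apply/funext => z; rewrite psd_linear.
Qed.

HB.instance Definition _ :=
  GRing.isSubmodClosed.Build C (V -> C) separated separated_submod.

Record separation := Separation { sep_val : V -> C; _ : sep_val \in separated }.
HB.instance Definition _ := [isSub for sep_val].
HB.instance Definition _ := [Choice of separation by <:].
HB.instance Definition _ := [SubChoice_isSubLmodule of separation by <:].

Fact separated_repr x : (K ^~ x) \in separated.
Proof. by apply/asboolP; exists x. Qed.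

Definition sep_class x := Separation (separated_repr x).

Lemma sep_class_linear : linear sep_class.
Proof.
move=> c x y; apply: val_inj; rewrite [RHS]linearP /=; apply/funext => z.
exact: psd_linear.
Qed.

HB.instance Definition _ :=
  GRing.isLinear.Build C V separation *:%R sep_class sep_class_linear.

Lemma sep_class_surj (f : separation) : exists x, sep_class x = f.
Proof.
by case: f => f fP; have /asboolP[x xf] := fP; exists x; apply: val_inj.
Qed.

Definition sep_repr f : V := sval (cid (sep_class_surj f)).

Lemma sep_reprK : cancel sep_repr sep_class.
Proof. by move=> f; rewrite /sep_repr; case: cid. Qed.

(** The arguments are exchanged because [K] is linear in its second argument and
    a dot product in its first. *)
Definition sep_dot (f g : separation) : C := K (sep_repr g) (sep_repr f).

Lemma sep_dotE x y : sep_dot (sep_class x) (sep_class y) = K y x.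
Proof.
have E z t : K t (sep_repr (sep_class z)) = K t z.
  by have /(congr1 sep_val)/(congr1 (@^~ t)) := sep_reprK (sep_class z).
by rewrite /sep_dot E -psd_conj E psd_conj.
Qed.

Lemma sep_dot_bilinear : bilinear_for *%R (Num.conj \; *%R) sep_dot.
Proof.
split=> [g|f] c u v; rewrite -[u]sep_reprK -[v]sep_reprK -linearP.
  by rewrite -[g]sep_reprK !sep_dotE psd_linear.
by rewrite -[f]sep_reprK !sep_dotE psdDl psdZl.
Qed.

Lemma sep_dot_hermitian f g : sep_dot f g = (-1) ^+ false * (sep_dot g f)^*.
Proof. by rewrite expr0 mul1r psd_conj. Qed.

Lemma sep_dot_pos f : f != 0 -> 0 < sep_dot f f.
Proof.
move=> f0; rewrite lt_def psd_ge0 andbT; apply: contra f0 => /eqP f0.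
rewrite -[f]sep_reprK; apply/eqP/val_inj/funext => y.
exact: psd_null.
Qed.

HB.instance Definition _ := bilinear_isBilinear.Build C separation separation C
  *%R (Num.conj \; *%R) sep_dot sep_dot_bilinear.
HB.instance Definition _ := isHermitianSesquilinear.Build C separation false
  Num.conj sep_dot sep_dot_hermitian.
HB.instance Definition _ := isDotProduct.Build C separation sep_dot sep_dot_pos.

Lemma psd_separation : exists (D : preHilbert C) (q : {linear V -> D}),
  (forall v, exists x, q x = v) /\ (forall x y, inner (q x) (q y) = K x y).
Proof.
exists (@PreHilbert C separation (sep_dot : {dot separation for Num.conj})).
exists (sep_class : {linear V -> separation}).
by split=> [|x y]; [exact: sep_class_surj | exact: sep_dotE].
Qed.

End Separation.

(** * Limits of scalars and inner products *)

Section Inner.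
Variables (C : numClosedFieldType) (D : preHilbert C).

Fact inner_linear (x : D) : scalar (inner x).
Proof. by move=> c y z; apply: linearPl. Qed.

Fact inner_conj (x y : D) : (inner x y)^* = inner y x.
Proof.
have := @hermC C false Num.conj D (ph_dot D) x y.
by rewrite expr0 mul1r.
Qed.

Fact inner_ge0 (x : D) : 0 <= inner x x.
Proof. exact: dnorm_ge0. Qed.

Definition inner_psd := PsdForm inner_linear inner_conj inner_ge0.

Lemma innerE (x y : D) : inner x y = inner_psd x y.
Proof. by []. Qed.

Lemma hnormE (x : D) : hnorm x = psd_norm inner_psd x.
Proof. by []. Qed.

Lemma hnorm_ge0 (x : D) : 0 <= hnorm x.
Proof. exact: (psd_norm_ge0 inner_psd). Qed.

Lemma hnorm_eq0 (x : D) : hnorm x = 0 -> x = 0.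
Proof. by move/eqP; rewrite sqrtC_eq0 dnorm_eq0 => /eqP. Qed.

End Inner.

Lemma cvg_conj (C : numClosedFieldType) (u : nat -> C) (l : C) :
  u @ \oo --> l -> (fun n => (u n)^*) @ \oo --> l^*.
Proof.
move=> /cvgrPdist_lt ul; apply/cvgrPdist_lt => e /ul.
by apply: filterS => n; rewrite -rmorphB norm_conjC.
Qed.

(** The order of [C] is partial: the limit is first seen to be real because it is
    its own conjugate, and only then compared with 0. *)
Lemma lim_ge0 (C : numClosedFieldType) (u : nat -> C) (l : C) :
  (\forall n \near \oo, 0 <= u n) -> u @ \oo --> l -> 0 <= l.
Proof.
move=> u0 ul.
have lr : l \is Num.real.
  apply/CrealP; apply: (@cvg_unique _ (@norm_hausdorff C C) (u @ \oo)) => //.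
  apply: cvg_trans (cvg_conj ul); apply: near_eq_cvg.
  by apply: filterS u0 => n un; rewrite /= (CrealP (ger0_real un)).
rewrite real_leNgt ?real0 //; apply/negP => l0.
have /cvgrPdist_lt/(_ (- l)) := ul; rewrite oppr_gt0 => /(_ l0) le.
have [n [un]] := filter_ex (filterI u0 le).
rewrite distrC ger0_norm; last by rewrite subr_ge0 (le_trans (ltW l0)).
by rewrite gtrDr le_gtF.
Qed.

(** * Completion of a pre-Hilbert space *)

Definition complete_scalars (C : numClosedFieldType) : Prop :=
  forall u : nat -> C,
    (forall e : C, 0 < e -> exists N, forall m n, (N <= m)%N -> (N <= n)%N ->
       `|u m - u n| < e) -> exists l : C, u @ \oo --> l.

Definition archimedean_scalars (C : numClosedFieldType) : Prop :=
  forall e : C, 0 < e -> exists N, N.+1%:R^-1 < e.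

Section Completion.
Variable C : numClosedFieldType.
Hypotheses (C_complete : complete_scalars C) (C_arch : archimedean_scalars C).

Section CauchySequences.
Variable D : preHilbert C.

Definition is_cauchy : {pred nat -> D} := fun u =>
  `[< forall e : C, 0 < e -> exists N, forall m n, (N <= m)%N -> (N <= n)%N ->
      hnorm (u m - u n) < e >].

Lemma is_cauchy_submod : submod_closed is_cauchy.
Proof.
split.
  apply/asboolP => e e0; exists 0%N => m n _ _.
  by rewrite subrr hnormE psd_norm0.
move=> c u w /asboolP hu /asboolP hw; apply/asboolP => e e0.
have c0 : 0 < `|c| + 1 by rewrite ltr_wpDl ?ltr01.
have e1 : 0 < e / 2 / (`|c| + 1) by rewrite !divr_gt0.
have e2 : 0 < e / 2 by rewrite divr_gt0.
have [N1 h1] := hu _ e1; have [N2 h2] := hw _ e2.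
exists (maxn N1 N2) => m n; rewrite !geq_max => /andP[m1 m2] /andP[n1 n2].
have -> : (c *: u + w) m - (c *: u + w) n = c *: (u m - u n) + (w m - w n).
  by rewrite scalerBr opprD addrACA.
rewrite hnormE; apply: le_lt_trans (psd_normD _ _ _) _; rewrite psd_normZ.
rewrite [e in _ < e](splitr e) ler_ltD ?h2 //.
have := h1 m n m1 n1; rewrite hnormE => /ltW h.
apply: le_trans (ler_wpM2l (normr_ge0 c) h) _.
by rewrite mulrA ler_pdivrMr // mulrC ler_pM2l // lerDl ler01.
Qed.

HB.instance Definition _ :=
  GRing.isSubmodClosed.Build C (nat -> D) is_cauchy is_cauchy_submod.

Record cauchy_seq := CauchySeq { cs_val :> nat -> D; _ : cs_val \in is_cauchy }.
HB.instance Definition _ := [isSub for cs_val].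
HB.instance Definition _ := [Choice of cauchy_seq by <:].
HB.instance Definition _ := [SubChoice_isSubLmodule of cauchy_seq by <:].

Lemma cauchy_seqP (u : cauchy_seq) (e : C) : 0 < e ->
  exists N, forall m n, (N <= m)%N -> (N <= n)%N -> hnorm (u m - u n) < e.
Proof. by case: u => u uP; move: e; apply/asboolP. Qed.

Lemma cauchy_seq_bounded (u : cauchy_seq) :
  exists M N, 0 < M /\ forall n, (N <= n)%N -> hnorm (u n) <= M.
Proof.
have [N h] := cauchy_seqP u ltr01; exists (hnorm (u N) + 1), N.
split=> [|n Nn]; first by rewrite ltr_wpDl ?ltr01 ?hnorm_ge0.
rewrite -[u n](subrK (u N)) addrC !hnormE.
by apply: le_trans (psd_normD _ _ _) _; rewrite lerD2l ltW ?h.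
Qed.

Lemma inner_cvg (u w : cauchy_seq) :
  exists l : C, (fun n => inner (u n) (w n)) @ \oo --> l.
Proof.
apply: C_complete => e e0.
have [M1 [N1 [M10 b1]]] := cauchy_seq_bounded u.
have [M2 [N2 [M20 b2]]] := cauchy_seq_bounded w.
have [N3 h3] := cauchy_seqP u (divr_gt0 (divr_gt0 e0 (ltr0Sn C 1)) M20).
have [N4 h4] := cauchy_seqP w (divr_gt0 (divr_gt0 e0 (ltr0Sn C 1)) M10).
exists (maxn (maxn N1 N2) (maxn N3 N4)) => m n.
rewrite !geq_max => /andP[/andP[m1 m2] /andP[m3 m4]] /andP[/andP[n1 n2] /andP[n3 n4]].
have -> : inner (u m) (w m) - inner (u n) (w n) =
    inner (u m - u n) (w m) + inner (u n) (w m - w n).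
  by rewrite !innerE psdBl psdBr subrKA.
apply: le_lt_trans (ler_normD _ _) _; rewrite (splitr e) ltrD //.
  apply: le_lt_trans (psd_CauchySchwarz (inner_psd D) _ _) _.
  apply: le_lt_trans (ler_wpM2l (psd_norm_ge0 _ _) (b2 m m2)) _.
  by rewrite -ltr_pdivlMr // h3.
apply: le_lt_trans (psd_CauchySchwarz (inner_psd D) _ _) _.
apply: le_lt_trans (ler_wpM2r (psd_norm_ge0 _ _) (b1 n n1)) _.
by rewrite mulrC -ltr_pdivlMr // h4.
Qed.

Definition cs_form (u w : cauchy_seq) : C := sval (cid (inner_cvg u w)).

Lemma cs_form_cvg (u w : cauchy_seq) :
  (fun n => inner (u n) (w n)) @ \oo --> cs_form u w.
Proof. by rewrite /cs_form; case: cid. Qed.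

Lemma cs_form_unique (u w : cauchy_seq) (l : C) :
  (fun n => inner (u n) (w n)) @ \oo --> l -> cs_form u w = l.
Proof. by apply: cvg_unique; [exact: norm_hausdorff | exact: cs_form_cvg]. Qed.

Fact cs_form_linear u : scalar (cs_form u).
Proof.
move=> c v w; apply: cs_form_unique.
under eq_fun => n do rewrite inner_linear.
by apply: cvgD; [apply: cvgMr|]; apply: cs_form_cvg.
Qed.

Fact cs_form_conj u w : (cs_form u w)^* = cs_form w u.
Proof.
apply/esym/cs_form_unique; under eq_fun => n do rewrite -inner_conj.
exact/cvg_conj/cs_form_cvg.
Qed.

Fact cs_form_ge0 u : 0 <= cs_form u u.
Proof.
apply: (@lim_ge0 _ (fun n => inner (u n) (u n))); last exact: cs_form_cvg.
by apply: nearW => n; apply: inner_ge0.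
Qed.

Definition cs_psd := PsdForm cs_form_linear cs_form_conj cs_form_ge0.

Lemma cs_norm_le (u : cauchy_seq) (e : C) N : 0 <= e ->
  (forall n, (N <= n)%N -> hnorm (u n) <= e) -> psd_norm cs_psd u <= e.
Proof.
move=> e0 h; rewrite -ler_sqr ?nnegrE ?psd_norm_ge0 // psd_normE -subr_ge0.
apply: (@lim_ge0 _ (fun n => e ^+ 2 - inner (u n) (u n))); last first.
  by apply: cvgB; [apply: cvg_cst | apply: cs_form_cvg].
exists N => // n /= Nn.
by rewrite subr_ge0 innerE -psd_normE ler_sqr ?nnegrE ?psd_norm_ge0 ?h.
Qed.

Fact const_cauchy (d : D) : (fun=> d) \in is_cauchy.
Proof.
by apply/asboolP => e e0; exists 0%N => m n _ _; rewrite subrr hnormE psd_norm0.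
Qed.

Definition cs_const (d : D) := CauchySeq (const_cauchy d).

Lemma cs_const_linear : linear cs_const.
Proof. by move=> c u v; apply: val_inj; rewrite [RHS]linearP. Qed.

HB.instance Definition _ :=
  GRing.isLinear.Build C D cauchy_seq *:%R cs_const cs_const_linear.

Lemma cs_form_const (v w : D) : cs_form (cs_const v) (cs_const w) = inner v w.
Proof. by apply: cs_form_unique; apply: cvg_cst; exact _. Qed.

End CauchySequences.

(** The completion is the separation of the space of Cauchy sequences, with [D]
    embedded by constant sequences.  A Cauchy sequence of classes [x n] is
    approximated up to [1 / (n + 1)] by vectors [d n] of [D]; then [d] is itself a
    Cauchy sequence, and its class is the limit of [x]. *)
Theorem completion_exists (D : preHilbert C) :
  exists (H : preHilbert C) (J : {linear D -> H}), is_completion J.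
Proof.
have [H [q [q_surj q_inner]]] := psd_separation (cs_psd D).
pose J : {linear D -> H} := q \o @cs_const D.
have q_norm u : hnorm (q u) = psd_norm (cs_psd D) u by rewrite /hnorm q_inner.
have J_inner v w : inner (J v) (J w) = inner v w.
  exact: etrans (q_inner _ _) (cs_form_const v w).
have J_norm v w : hnorm (J v - J w) = hnorm (v - w).
  by rewrite -linearB /hnorm J_inner.
have J_approx (u : cauchy_seq D) e : 0 < e ->
    exists N, forall n, (N <= n)%N -> hnorm (q u - J (u n)) <= e.
  move=> e0; have [N h] := cauchy_seqP u e0; exists N => n Nn.
  rewrite -linearB q_norm; apply: (@cs_norm_le _ _ _ N); first exact: ltW.
  by move=> m Nm; apply/ltW/h.
have J_dense x e : 0 < e -> exists v, hnorm (x - J v) < e.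
  move=> e0; have [u <-] := q_surj x.
  have [N h] := J_approx u _ (divr_gt0 e0 (ltr0Sn C 1)); exists (u N).
  by apply: le_lt_trans (h _ _) _; rewrite // ltr_pdivrMr // ltr_pMr ?ltr1n.
exists H, J; split=> // x x_cauchy.
have /choice[d dP] : forall n, exists v, hnorm (x n - J v) < n.+1%:R^-1.
  by move=> n; apply: J_dense; rewrite invr_gt0 ltr0Sn.
have d_close e : 0 < e ->
    exists N, forall n, (N <= n)%N -> hnorm (x n - J (d n)) < e.
  move=> /C_arch[N Ne]; exists N => n Nn; apply: lt_trans (dP n) _.
  by apply: le_lt_trans Ne; rewrite lef_pV2 ?posrE ?ltr0Sn // ler_nat ltnS.
have d_cauchy : d \in @is_cauchy D.
  apply/asboolP => e e0; have e3 : 0 < e / 3 by rewrite divr_gt0 // ltr0Sn.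
  have [N1 h1] := d_close _ e3; have [N2 h2] := x_cauchy _ e3.
  exists (maxn N1 N2) => m n; rewrite !geq_max => /andP[m1 m2] /andP[n1 n2].
  rewrite -J_norm hnormE; apply: le_lt_trans (psd_dist_triangle _ (x m) _ _) _.
  have -> : e = e / 3 + (e / 3 + e / 3) by field.
  rewrite ltrD // ?[psd_norm _ (J (d m) - _)]psd_normB ?h1 //.
  apply: le_lt_trans (psd_dist_triangle _ (x n) _ _) _.
  by rewrite ltrD ?h1 ?h2.
exists (q (CauchySeq d_cauchy)) => e e0.
have e2 : 0 < e / 2 by rewrite divr_gt0 // ltr0Sn.
have [N1 h1] := d_close _ e2.
have [N2 h2] := J_approx (CauchySeq d_cauchy) _ e2.
exists (maxn N1 N2) => n; rewrite geq_max => /andP[n1 n2].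
rewrite hnormE; apply: le_lt_trans (psd_dist_triangle _ (J (d n)) _ _) _.
by rewrite (splitr e) ltr_leD ?h1 // psd_normB h2.
Qed.

End Completion.

(** * Schurmann triples on an augmented *-algebra *)

Section GNS.
Variables (C : numClosedFieldType) (A : augmented_star_algebra C).
Implicit Types (a b x y : A).

Lemma star1 : star (1 : A) = 1.
Proof. by rewrite -[LHS]mulr1 -{2}(starK (1 : A)) -starM mulr1 starK. Qed.

(** The projection of the algebra onto the kernel of [eps] along the scalars, so
    that positivity of a generating functional applies to it. *)
Definition center a : A := a - eps a *: 1.

Lemma center_linear : linear center.
Proof.
move=> c a b; rewrite /center eps_linear scalerDl scalerBr scalerA opprD.
by rewrite addrACA.
Qed.

HB.instance Definition _ := GRing.isLinear.Build C A A *:%R center center_linear.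

Lemma eps_center a : eps (center a) = 0.
Proof.
have := eps_linear (- eps a) 1 a.
by rewrite eps1 mulr1 scaleNr [- _ + a]addrC => ->; rewrite addNr.
Qed.

Lemma center_id a : eps a = 0 -> center a = a.
Proof. by rewrite /center => ->; rewrite scale0r subr0. Qed.

Lemma star_center a : star (center a) = center (star a).
Proof.
have := star_linear (- eps a) 1 a.
by rewrite /center eps_star star1 rmorphN !scaleNr ![- _ + _]addrC.
Qed.

Lemma mul_center a b : a * center b = a * b - eps b *: a.
Proof. by rewrite /center mulrBr -scalerAr mulr1. Qed.

Section Form.
Variables (psi : {scalar A}) (psiP : generating_functional psi).

Definition gns_fun a b : C := psi (star (center a) * center b).

Fact gns_linear a : scalar (gns_fun a).
Proof. by move=> c x y; rewrite /gns_fun linearP mulrDr -scalerAr linearP. Qed.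

Fact gns_conj a b : (gns_fun a b)^* = gns_fun b a.
Proof. by case: psiP => _ psi_herm _; rewrite -psi_herm starM starK. Qed.

Fact gns_ge0 a : 0 <= gns_fun a a.
Proof. by case: psiP => _ _; apply; apply: eps_center. Qed.

Definition gns_form := PsdForm gns_linear gns_conj gns_ge0.

End Form.

Lemma inner_inj (D : preHilbert C) (v w : D) :
  (forall u : D, inner u v = inner u w) -> v = w.
Proof.
move=> h; apply/eqP; rewrite -subr_eq0; apply/eqP/hnorm_eq0.
by rewrite /hnorm innerE psdBr -!innerE h subrr sqrtC0.
Qed.

(** The cocycle is the quotient map [q] for [gns_form], so that [pi a (q b)] is
    forced to be [q (a * center b)].  This depends on [q b] only, because
    multiplication by [star a] on the kernel of [eps] is adjoint to multiplication
    by [a] for the form. *)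
Theorem gns_construction (psi : {scalar A}) : generating_functional psi ->
  exists (D : preHilbert C) (pi : A -> D -> D) (eta : {linear A -> D}),
    schurmann_triple pi eta psi /\ (forall v, exists a, eta a = v).
Proof.
move=> psiP; have [psi1 psi_herm _] := psiP.
have [D [q [q_surj q_inner]]] := psd_separation (gns_form psiP).
have [s sK] := choice q_surj.
pose pi a v := q (a * center (s v)).
have q_adj a x y :
    inner (q (star a * center x)) (q y) = inner (q x) (q (a * center y)).
  rewrite !q_inner /= /gns_fun !(@center_id (_ * center _)) ?epsM ?eps_center ?mulr0 //.
  by rewrite starM starK mulrA.
have pi_q a x : pi a (q x) = q (a * center x).
  apply: inner_inj => u; have [y <-] := q_surj u.
  by rewrite /pi -!q_adj sK.
have q1 : q 1 = 0.
  apply: inner_inj => u; have [y <-] := q_surj u.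
  rewrite q_inner /= /gns_fun /(center 1) eps1 scale1r subrr mulr0 linear0.
  by rewrite innerE psd0r.
have q_center x : q (center x) = q x.
  by rewrite /center linearB linearZ /= q1 scaler0 subr0.
exists D, pi, q; split; last by [].
split=> [|a b||a b].
- split=> [a c v w|v c a b|v|a b v|a v w].
  + have [x <-] := q_surj v; have [y <-] := q_surj w.
    by rewrite -linearP !pi_q linearP mulrDr -scalerAr linearP.
  + by rewrite /pi mulrDl -scalerAl linearP.
  + by rewrite /pi mul1r q_center sK.
  + have [x <-] := q_surj v.
    by rewrite !pi_q [center (b * _)]center_id ?epsM ?eps_center ?mulr0 ?mulrA.
  + have [x <-] := q_surj v; have [y <-] := q_surj w.
    by rewrite !pi_q q_adj.
- by rewrite pi_q mul_center linearB linearZ subrK.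
- exact: psi_herm.
- rewrite q_inner /= /gns_fun star_center starK mul_center /center mulrBl.
  rewrite -scalerAl mul1r scalerBr !linearB !linearZ /= psi1.
  by rewrite /GRing.scale /= !opprK oppr0; ring.
Qed.

(** The axioms of a Schurmann triple mention only the linear structure and the
    inner product of [D], so a surjective isometry carries it along. *)
Lemma transport_triple (D D' : preHilbert C) (U : {linear D -> D'})
    (pi : A -> D -> D) (eta : {linear A -> D}) (psi : {scalar A}) :
  (forall v, exists w, U w = v) ->
  (forall v w, inner (U v) (U w) = inner v w) ->
  schurmann_triple pi eta psi ->
  exists2 pi' : A -> D' -> D', forall a v, pi' a (U v) = U (pi a v)
    & schurmann_triple pi' (U \o eta : {linear A -> D'}) psi.
Proof.
move=> U_surj U_inner [[pi_lin pi_lin' pi1 piM pi_adj] coc herm psi_eq].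
have [s sK] := choice U_surj.
have U_inj : injective U.
  by move=> v w e; apply: inner_inj => u; rewrite -!U_inner e.
have sU v : s (U v) = v by apply: U_inj; rewrite sK.
exists (fun a v => U (pi a (s v))) => [a v|]; first by rewrite sU.
split=> [|a b||a b] /=.
- split=> [a c v w|v c a b|v|a b v|a v w].
  + rewrite -linearP -pi_lin; congr (U (pi a _)).
    by apply: U_inj; rewrite linearP !sK.
  + by rewrite -linearP -pi_lin'.
  + by rewrite pi1 sK.
  + by rewrite sU piM.
  + by rewrite -{1}[w]sK -{2}[v]sK !U_inner.
- by rewrite coc linearD linearZ sU.
- exact: herm.
- by rewrite U_inner psi_eq.
Qed.

Lemma eps_id_representation (D : preHilbert C) :
  star_representation (@eps_id C A D).
Proof.
rewrite /eps_id; split=> [a c v w|v c a b|v|a b v|a v w].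
- by rewrite scalerDr !scalerA mulrC.
- by rewrite eps_linear scalerDl scalerA.
- by rewrite eps1 scale1r.
- by rewrite epsM scalerA.
- by rewrite !innerE psdZl psdZr eps_star conjCK.
Qed.

Lemma zero_functional_generating : generating_functional (\0 : {scalar A}).
Proof. by split=> [//|a|a _] /=; rewrite ?conjC0. Qed.

Lemma zero_cocycle_triple (D : preHilbert C) (eta : {linear A -> D}) :
  (forall a, eta a = 0) -> schurmann_triple (@eps_id C A D) eta (\0 : {scalar A}).
Proof.
move=> eta0; split=> [|a b||a b]; first exact: eps_id_representation.
- by rewrite !eta0 /eps_id !scaler0 addr0.
- by case: zero_functional_generating.
- by rewrite !eta0 innerE psd0r /= mulr0 mul0r subr0 addr0 oppr0.
Qed.

End GNS.

(** * Cocycles on groups generated by involutions *)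

Section Span.
Variables (C : numClosedFieldType) (D : preHilbert C) (S : D -> Prop).

Lemma span_mem v : S v -> Defs.span S v.
Proof.
by move=> Sv; exists 1%N, (fun=> 1), (fun=> v); rewrite big_ord1 scale1r.
Qed.

Lemma span0 : Defs.span S 0.
Proof.
exists 0%N, (fun=> 0), (fun=> 0).
by split=> [[]|]; rewrite ?big_ord0.
Qed.

Lemma spanD v w : Defs.span S v -> Defs.span S w -> Defs.span S (v + w).
Proof.
move=> [m [c [x [Sx ->]]]] [n [d [y [Sy ->]]]].
exists (m + n)%N.
exists (fun i => match fintype.split i with inl j => c j | inr k => d k end).
exists (fun i => match fintype.split i with inl j => x j | inr k => y k end).
split=> [i|]; first by case: fintype.split.
rewrite big_split_ord /=; congr (_ + _); apply: eq_bigr => i _.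
  by rewrite (unsplitK (inl i)).
by rewrite (unsplitK (inr i)).
Qed.

Lemma spanZ c v : Defs.span S v -> Defs.span S (c *: v).
Proof.
move=> [n [d [y [Sy ->]]]]; exists n, (fun i => c * d i), y; split=> //.
by rewrite scaler_sumr; apply: eq_bigr => i _; rewrite scalerA.
Qed.

Lemma spanN v : Defs.span S v -> Defs.span S (- v).
Proof. by rewrite -scaleN1r; apply: spanZ. Qed.

Lemma span_linear (H : preHilbert C) (T : H -> Prop) (J : {linear D -> H}) :
  (forall v, S v -> T (J v)) ->
  forall v, Defs.span S v -> Defs.span T (J v).
Proof.
move=> ST _ [n [c [y [Sy ->]]]]; exists n, c, (J \o y).
split=> [i|]; first exact/ST/Sy.
by rewrite linear_sum; apply: eq_bigr => i _; rewrite linearZ.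
Qed.

End Span.

(** The induction principle of a group generated by involutions: a submonoid that
    contains the generating involutions is closed under inverses, because an
    involution is its own inverse, and so it is the whole group. *)
Definition generated_by_involutions (G : groupType) : Prop :=
  forall P : G -> Prop,
    P 1%g -> (forall g h, P g -> P h -> P (g * h)%g) ->
    (forall g, (g * g)%g = 1%g -> P g) -> forall g, P g.

Section Involutions.
Variables (C : numClosedFieldType) (G : groupType).
Hypothesis G_inv : generated_by_involutions G.
Let A := group_star_algebra C G.
Variables (D : preHilbert C) (pi : A -> D -> D) (eta : {linear A -> D}).
Hypotheses (pi1 : forall v, pi 1 v = v) (eta_coc : cocycle pi eta).

Definition increment (v : D) : Prop :=
  exists (a : A) (w : D), v = pi a w - eps a *: w.

Let delta (g : G) : A := monalg.mkmalgU g 1.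

Let delta1 : delta 1%g = 1.
Proof. by []. Qed.

Let deltaM g h : delta (g * h)%g = delta g * delta h.
Proof. by rewrite /delta [RHS](ga_mulrUU (1 : C) 1 g h) mulr1. Qed.

Let eta_delta1 : eta (delta 1%g) = 0.
Proof.
have := eta_coc (delta 1%g) (delta 1%g).
rewrite {1 2}delta1 mulr1 pi1 [eps _]ga_epsU scale1r.
by rewrite -{1}[eta 1]addr0 => /addrI.
Qed.

Let eta_deltaM g h : eta (delta (g * h)%g) =
  (pi (delta g) (eta (delta h)) - eps (delta g) *: eta (delta h)) +
  (eta (delta g) + eta (delta h)).
Proof.
rewrite deltaM eta_coc ![eps _]ga_epsU !scale1r.
by rewrite [in RHS](addrC (eta (delta g))) addrA subrK.
Qed.

(** Modulo increments a cocycle is additive on the group and kills twice every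
    involution, hence every involution because 2 is invertible. *)
Lemma cocycle_increments a : Defs.span increment (eta a).
Proof.
have incr g v : Defs.span increment (pi (delta g) v - eps (delta g) *: v).
  by apply: span_mem; exists (delta g), v.
have eta_g : forall g, Defs.span increment (eta (delta g)).
  apply: G_inv => [|g h hg hh|g gg]; first by rewrite eta_delta1; apply: span0.
    by rewrite eta_deltaM; apply/spanD/spanD.
  have := eta_deltaM g g; rewrite gg eta_delta1 => /esym/eqP.
  rewrite addrC addr_eq0 -mulr2n -scaler_nat => /eqP e.
  rewrite -[eta _](scalerK (_ : 2 != 0 :> C)) ?pnatr_eq0 // e.
  exact/spanZ/spanN.
elim/ga_ind: a => [|a b ha hb|c g]; first by rewrite linear0; apply: span0.
  by rewrite linearD; apply: spanD.
have -> : monalg.mkmalgU g c = c *: delta g :> A.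
  by rewrite [RHS]ga_scaleU mulr1.
by rewrite linearZ; apply: spanZ.
Qed.

End Involutions.

(** * The group p2 *)

Lemma mulg1_inv (G : groupType) (g h : G) : (g * h = 1)%g -> (g^-1 = h)%g.
Proof. by move=> gh; rewrite -[h](mulKg g) gh mulg1. Qed.

Section PresentedGroup.
Variables (X : choiceType) (rels : seq (word X)).

Lemma word_class_cat (u v : word X) :
  word_class rels (u ++ v) = (word_class rels u * word_class rels v)%g.
Proof. exact/esym/pg_mulE. Qed.

Lemma word_class_rel (w : word X) : w \in rels -> word_class rels w = 1%g.
Proof.
move=> wr; apply/word_classP.
by have := weqv_rel [::] [::] wr; rewrite cats0.
Qed.

Lemma word_class_letterV x e :
  word_class rels [:: (x, ~~ e)] = (word_class rels [:: (x, e)])^-1%g.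
Proof.
apply/esym/mulg1_inv; rewrite -word_class_cat; apply/word_classP.
exact: (weqv_cancel rels [::] [::] x e).
Qed.

End PresentedGroup.

(** The last three relators say that [r], [ra] and [rb] are involutions, and
    [a = r (ra)], [b = r (rb)]. *)
Lemma p2_generated_by_involutions : generated_by_involutions p2.
Proof.
move=> P P1 PM Pinv.
pose letter i : p2 := word_class p2_relators [:: (inord i, true)].
have rr : (letter 2 * letter 2 = 1)%g.
  rewrite -word_class_cat; apply: word_class_rel.
  by rewrite /p2_relators !inE eqxx ?orbT.
have r_invol i : (i < 2)%N ->
    ((letter 2%N * letter i) * (letter 2%N * letter i) = 1)%g.
  move=> i2; pose l k := [:: (inord k : 'I_3, true)].
  have : word_class p2_relators ((l 2 ++ l i) ++ l 2 ++ l i) = 1%g.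
    apply: word_class_rel.
    by case: i i2 => [|[|]] // _; rewrite /p2_relators !inE eqxx ?orbT.
  by rewrite !word_class_cat.
have rV : ((letter 2)^-1 = letter 2)%g by apply: mulg1_inv.
have Pletter (j : 'I_3) : P (word_class p2_relators [:: (j, true)]) /\
    P (word_class p2_relators [:: (j, false)]).
  rewrite (word_class_letterV _ j true) -[j]inord_val -/(letter j).
  have [j2|j2] := ltnP j 2.
    have Pr := Pinv _ rr; have Prj := Pinv _ (r_invol _ j2).
    have -> : letter j = (letter 2 * (letter 2 * letter j))%g.
      by rewrite mulgA rr mul1g.
    split; first exact: PM.
    by rewrite invgM (mulg1_inv (r_invol _ j2)) rV; apply: PM.
  have -> : val j = 2%N by apply/eqP; rewrite eqn_leq j2 -ltnS ltn_ord.
  by rewrite rV; split; apply: Pinv.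
move=> g; rewrite -[g]word_classK.
elim: (repr g) => [|[j e] w IH]; first exact: P1.
rewrite -cat1s word_class_cat; apply: PM IH.
by case: e; case: (Pletter j).
Qed.

(** * The complex numbers as scalars *)

Section ComplexScalars.
Variable R : realType.
Local Open Scope complex_scope.

Lemma complex_archimedean : archimedean_scalars (R[i] : numClosedFieldType).
Proof.
move=> e e0; have er : e = (complex.Re e)%:C by rewrite RRe_real ?gtr0_real.
have r0 : 0 < complex.Re e by rewrite -ltcR -er.
exists (Num.bound (complex.Re e)^-1).
rewrite er -(rmorph_nat (real_complex R)) -fmorphV ltcR invf_plt ?posrE ?ltr0Sn //.
by rewrite (lt_trans (archi_boundP _)) ?invr_ge0 ?ltr_nat // ltW.
Qed.

Lemma real_cauchy_cvg (u : nat -> R) :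
  (forall e : R, 0 < e -> exists N, forall m n, (N <= m)%N -> (N <= n)%N ->
     `|u m - u n| < e) -> exists l : R, u @ \oo --> l.
Proof.
move=> hu; have : cauchy (u @ \oo).
  apply: cauchy_exP => e /hu[N h]; exists (u N), N => // n /= Nn.
  by rewrite /ball /= h.
by move/cauchy_cvg => uc; exists (lim (u @ \oo)).
Qed.

Lemma normc_le_ReIm (z : R[i]) :
  `|z| <= (`|complex.Re z| + `|complex.Im z|)%:C.
Proof.
rewrite normc_def lecR -[leRHS]ger0_norm ?addr_ge0 // -sqrtr_sqr ler_wsqrtr //.
rewrite sqrrD !real_normK ?num_real // -[X in _ <= X]addrA lerD2l.
by rewrite lerDr mulrn_wge0 ?mulr_ge0.
Qed.

Lemma complex_complete : complete_scalars (R[i] : numClosedFieldType).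
Proof.
move=> u hu.
have part (f : {additive R[i] -> R}) : (forall z, (`|f z|)%:C <= `|z|) ->
    exists l : R, (f \o u) @ \oo --> l.
  move=> f_le; apply: real_cauchy_cvg => e e0.
  have [|N h] := hu e%:C; first by rewrite ltcR.
  exists N => m n Nm Nn; rewrite /= -raddfB -ltcR.
  exact: le_lt_trans (f_le _) (h m n Nm Nn).
have [x ux] := part (@complex.Re R) (@normc_ge_Re R).
have Im_le (z : R[i]) : (`|complex.Im z|)%:C <= `|z|.
  by rewrite normc_def lecR -sqrtr_sqr ler_wsqrtr // lerDr sqr_ge0.
have [y uy] := part (@complex.Im R) Im_le.
exists (x +i* y); apply/cvgrPdist_lt => e e0.
have er : e = (complex.Re e)%:C by rewrite RRe_real ?gtr0_real.
have r0 : 0 < complex.Re e / 2 by rewrite divr_gt0 // -ltcR -er.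
have /cvgrPdist_lt/(_ _ r0) hx := ux; have /cvgrPdist_lt/(_ _ r0) hy := uy.
apply: filterS2 hx hy => n /= hx hy.
apply: le_lt_trans (normc_le_ReIm _) _; rewrite er ltcR !raddfB /=.
by rewrite [e in _ < e]splitr ltrD.
Qed.

End ComplexScalars.

(** * Gaussian cocycles, (GC) and (LK) *)

Section LevyKhinchin.
Variables (C : numClosedFieldType) (G : groupType).
Hypothesis G_inv : generated_by_involutions G.
Hypotheses (C_complete : complete_scalars C) (C_arch : archimedean_scalars C).
Let A := group_star_algebra C G.

Lemma gaussian_cocycle_eq0 (D : preHilbert C) (eta : {linear A -> D}) :
  gaussian_cocycle eta -> forall a, eta a = 0.
Proof.
move=> eta_g a.
have eps_id1 v : @eps_id C A D 1 v = v by rewrite /eps_id eps1 scale1r.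
have [n [c [y [y0 ->]]]] := cocycle_increments G_inv eps_id1 eta_g a.
by apply: big1 => i _; have [b [w ->]] := y0 i; rewrite subrr scaler0.
Qed.

Lemma involutions_GC : GC A.
Proof.
move=> D eta /gaussian_cocycle_eq0 eta0; exists (\0 : {scalar A}).
exact: zero_cocycle_triple.
Qed.

(** Since the increments span [D], the remainder space is all of [H] and the
    Gaussian space is 0, so the remainder triple is the whole triple of [psi]. *)
Lemma involutions_LK : LK A.
Proof.
move=> psi psiP; have [D [pi [eta [tri eta_surj]]]] := gns_construction psiP.
have [[_ _ pi1 _ _] eta_coc _ _] := tri.
have [H [J J_compl]] := completion_exists C_complete C_arch D.
have [_ J_inner J_dense] := J_compl.
have remainder_full x : remainder_space J pi x.
  move=> e e0; have [v xv] := J_dense x e e0; exists (J v) => //.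
  have [a <-] := eta_surj v.
  apply: (span_linear _ (cocycle_increments G_inv pi1 eta_coc a)).
  by move=> _ [b [w ->]]; exists b, w.
have gaussian0 y : gaussian_space J pi y -> y = 0.
  move=> /(_ y (remainder_full y)) yy; apply: hnorm_eq0.
  by rewrite /hnorm yy sqrtC0.
pose PG : {linear H -> H} := \0; pose PR : {linear H -> H} := idfun.
exists D, pi, eta, H, J, PG, PR, (\0 : {scalar A}), psi; split.
- by [].
- by [].
- move=> x; split=> [y _|y /gaussian0 ->]; first by rewrite innerE psd0r.
  by rewrite innerE -psd_conj psd0r conjC0.
- move=> x; split=> [|y _]; first exact: remainder_full.
  by rewrite /= subrr innerE psd0r.
split.
- exact: zero_functional_generating.
- exact: psiP.
- by move=> a; rewrite /= add0r.
- exists (@eps_id C A _) => //.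
  by apply: zero_cocycle_triple => a; apply: val_inj.
pose U : {linear D -> image_space (PR \o J)} := to_image (PR \o J).
have U_surj v : exists w, U w = v.
  by case: v => x xP; have /asboolP[w wx] := xP; exists w; apply: val_inj.
have [pi' pi'E tri'] := transport_triple U_surj J_inner tri.
exists pi' => // a b; rewrite (pi'E a (eta b)) /=.
by rewrite linearB linearZ subrK.
Qed.

End LevyKhinchin.

Theorem proposition4p5 (R : realType) :
  let A := group_star_algebra R[i] p2 in
  [/\ forall (D : preHilbert R[i]) (eta : {linear A -> D}),
        gaussian_cocycle eta -> forall a : A, eta a = 0,
      GC A &
      LK A].
Proof.
have p2_inv := p2_generated_by_involutions.
split=> [D eta||].
- exact: gaussian_cocycle_eq0.
- exact: involutions_GC.
- exact: (involutions_LK p2_inv (@complex_complete R) (@complex_archimedean R)).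
Qed.
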